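(* Let $\mathcal{C}\subset\mathbb{R}^p$ be a closed bounded convex set with Euclidean diameter $\|\mathcal{C}\|_2$, let $\ell(\cdot;d):\mathcal{C}\to\mathbb{R}$ be convex and $L$-Lipschitz for every $d$ in the data universe, and let $\epsilon>0$. Let $\mathcal{D}=\{d_1,\dots,d_n\}$ be a data set, $\mathcal{L}(\theta;\mathcal{D})=\sum_{i=1}^n\ell(\theta;d_i)$ and $\theta^*\in\arg\min_{\theta\in\mathcal{C}}\mathcal{L}(\theta;\mathcal{D})$. Let $\theta^{priv}$ be the output of $\mathcal{A}_{\sf exp-samp}$, i.e. a sample from the distribution on $\mathcal{C}$ with density proportional to $\exp\left(-\frac{\epsilon}{2L\|\mathcal{C}\|_2}\mathcal{L}(\theta;\mathcal{D})\right)$. Then, with expectation over the randomness of the algorithm, $$\mathbb{E}\left[\mathcal{L}(\theta^{priv};\mathcal{D})-\mathcal{L}(\theta^*;\mathcal{D})\right]=O\left(\frac{pL\|\mathcal{C}\|_2}{\epsilon}\right).$$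
   Context: $O(\cdot)$ hides an absolute multiplicative constant. Densities are with respect to $p$-dimensional Lebesgue measure on $\mathcal{C}$; $\mathcal{C}$ has nonempty interior, so that the distribution is well defined. Lipschitz is with respect to the Euclidean norm. *)

(* Defs.v *)
From HB Require Import structures.
From mathcomp Require Import all_boot all_order all_algebra.
From mathcomp Require Import all_classical all_reals all_analysis.

Set Implicit Arguments.
Unset Strict Implicit.
Unset Printing Implicit Defensive.
Import Order.TTheory GRing.Theory Num.Theory.
Import numFieldNormedType.Exports.

Local Open Scope classical_set_scope.
Local Open Scope ring_scope.

(* The points of R^p are row vectors.  Their library norm is the sup norm; it
   gives the right closed, bounded and open sets, but the Euclidean norm has to
   be defined separately. *)

Section borel_rV.
Context {R : realType} {p : nat}.

Let coord (i : 'I_p) (v : 'rV[R]_p) : R := v ord0 i.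

Let rV_set0 : g_sigma_preimage coord set0.
Proof. exact: sigma_algebra0. Qed.

Let rV_setC A : g_sigma_preimage coord A -> g_sigma_preimage coord (~` A).
Proof. exact: sigma_algebraC. Qed.

Let rV_bigcup (F : (set 'rV[R]_p)^nat) :
  (forall i, g_sigma_preimage coord (F i)) ->
  g_sigma_preimage coord (\bigcup_i F i).
Proof. exact: sigma_algebra_bigcup. Qed.

(* The sigma-algebra generated by the coordinates, as the library does for
   n.-tuple T; on R^p it is the Borel sigma-algebra. *)
HB.instance Definition _ := @isMeasurable.Build default_measure_display
  'rV[R]_p (g_sigma_preimage coord) rV_set0 rV_setC rV_bigcup.

End borel_rV.

Lemma measurable_coord {R : realType} {p : nat} (i : 'I_p) :
  measurable_fun [set: 'rV[R]_p] (fun v => v ord0 i).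
Proof.
move=> _ Y mY; rewrite setTI; apply: sub_sigma_algebra => /=.
rewrite -bigcup_seq/=; exists i => /=; first by rewrite mem_index_enum.
by exists Y => //; rewrite setTI.
Qed.

Lemma measurable_fun_rV d (T : measurableType d) {R : realType} {p : nat}
    (f : T -> 'rV[R]_p) :
  (forall i, measurable_fun [set: T] (fun x => f x ord0 i)) ->
  measurable_fun [set: T] f.
Proof.
move=> mf; apply: measurability => // _ [B + <-].
rewrite -bigcup_seq => -[i _ [C mC <-]]; rewrite setTI.
exact: mf.
Qed.

Section lebesgue_rV.
Context {R : realType}.

Definition cons_rV (p : nat) (vt : 'rV[R]_p * measurableTypeR R) :
    'rV[R]_p.+1 :=
  row_mx (const_mx (vt.2 : R) : 'M[R]_1) vt.1.

Lemma measurable_cons_rV (p : nat) : measurable_fun setT (@cons_rV p).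
Proof.
apply: measurable_fun_rV => i.
have [j ->|j ->] := @split_ordP 1 p i.
- rewrite (_ : (fun x => _) = snd); first exact: measurable_snd.
  by apply/funext => x; exact: etrans (row_mxEl _ _ _ _) (mxE _ _ _ _).
- rewrite (_ : (fun x => _) = (fun v : 'rV[R]_p => v ord0 j) \o fst).
    exact: measurableT_comp (measurable_coord j) measurable_fst.
  by apply/funext => x; exact: row_mxEr.
Qed.

(* p-dimensional Lebesgue measure: R^0 is a point of mass 1, and the measure on
   R^(p+1) is the product of the measures on R^p and R. *)
Fixpoint lebesgue_rV (p : nat) : set 'rV[R]_p -> \bar R :=
  match p return set 'rV[R]_p -> \bar R with
  | 0 => \d_(0 : 'rV[R]_0)
  | q.+1 => pushforward (@lebesgue_rV q \x @lebesgue_measure R)%E (@cons_rV q)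
  end.
Arguments lebesgue_rV p _ : clear implicits.

Let lebesgue_rV_measure (p : nat) :
  exists mu : {measure set 'rV[R]_p -> \bar R}, lebesgue_rV p = mu.
Proof.
elim: p => [|p [mu IH]].
  by exists (\d_(0 : 'rV[R]_0) : {measure set _ -> \bar R}).
unshelve eexists.
  unshelve refine (pushforward (mu \x @lebesgue_measure R)%E (@cons_rV p) :
    {measure set _ -> \bar R}).
  exact: measurable_cons_rV.
by rewrite /= IH.
Qed.

Let lebesgue_rV0 p : lebesgue_rV p set0 = 0%E.
Proof. by have [mu ->] := lebesgue_rV_measure p. Qed.

Let lebesgue_rV_ge0 p A : (0 <= lebesgue_rV p A)%E.
Proof. by have [mu ->] := lebesgue_rV_measure p. Qed.

Let lebesgue_rV_sigma_additive p : semi_sigma_additive (lebesgue_rV p).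
Proof.
have [mu ->] := lebesgue_rV_measure p.
exact: measure_semi_sigma_additive.
Qed.

HB.instance Definition _ p := isMeasure.Build _ _ _ (lebesgue_rV p)
  (lebesgue_rV0 p) (@lebesgue_rV_ge0 p) (@lebesgue_rV_sigma_additive p).

End lebesgue_rV.
Arguments lebesgue_rV {R} p _.

Lemma cons_rV0 {R : realType} {p : nat} (vt : 'rV[R]_p * measurableTypeR R) :
  cons_rV vt ord0 ord0 = vt.2.
Proof.
rewrite (_ : ord0 = @lshift 1 p ord0); last exact: val_inj.
exact: etrans (row_mxEl _ _ _ _) (mxE _ _ _ _).
Qed.

Lemma cons_rV_lift {R : realType} {p : nat} (vt : 'rV[R]_p * measurableTypeR R)
    (i : 'I_p) :
  cons_rV vt ord0 (lift ord0 i) = vt.1 ord0 i.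
Proof.
rewrite (_ : lift ord0 i = @rshift 1 p i); last exact: val_inj.
exact: row_mxEr.
Qed.

Lemma lebesgue_rV_box {R : realType} {p : nat} (I : 'I_p -> interval R) :
  lebesgue_rV p [set v : 'rV[R]_p | forall i, v ord0 i \in I i] =
  (\prod_(i < p) lebesgue_measure [set` I i])%E.
Proof.
elim: p I => [|p IH] I.
  rewrite big_ord0 /= (_ : [set v | _] = setT); first by rewrite diracT.
  by apply/seteqP; split => // v _ [].
rewrite big_ord_recl /= /pushforward.
pose B := [set v : 'rV[R]_p | forall i, v ord0 i \in I (lift ord0 i)].
have mB : measurable B.
  rewrite (_ : B = \bigcap_(i in [set: 'I_p])
    ((fun v : 'rV[R]_p => v ord0 i) @^-1` [set` I (lift ord0 i)])).
    apply: fin_bigcap_measurable => // i _; rewrite -[X in measurable X]setTI.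
    by apply: measurable_coord => //; exact: measurable_itv.
  by apply/seteqP; split => [v h i _|v h i]; [exact: h|exact: (h i Logic.I)].
rewrite (_ : _ @^-1` _ = B `*` [set` I ord0]).
  by rewrite product_measure1E//= IH muleC.
apply/seteqP; split => -[v t] /=.
  move=> h; split => [i|]; first by have := h (lift ord0 i); rewrite cons_rV_lift.
  by have := h ord0; rewrite cons_rV0.
move=> [h1 h2] i; have [j ->|->] := unliftP ord0 i; last by rewrite cons_rV0.
by rewrite cons_rV_lift.
Qed.

Section exponential_sampling.
Context {R : realType} {p : nat}.
Implicit Types (C : set 'rV[R]_p).

Definition norm2 (v : 'rV[R]_p) : R := Num.sqrt (\sum_(i < p) v ord0 i ^+ 2).

Definition diameter2 C : R :=
  sup [set norm2 (x - y) | x in C & y in C].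

Definition lipschitz2_on (L : R) C (f : 'rV[R]_p -> R) :=
  {in C &, forall x y, `|f x - f y| <= L * norm2 (x - y)}.

Definition emp_loss (D : Type) (loss : 'rV[R]_p -> D -> R) n
    (data : n.-tuple D) (theta : 'rV[R]_p) : R :=
  \sum_(i < n) loss theta (tnth data i).

Definition is_argmin C (f : 'rV[R]_p -> R) (x : 'rV[R]_p) :=
  x \in C /\ {in C, forall y, f x <= f y}.

Definition has_density_prop_to d (Omega : measurableType d)
    (P : probability Omega R) (X : {RV P >-> 'rV[R]_p}) C
    (w : 'rV[R]_p -> R) :=
  forall A : set 'rV[R]_p, measurable A ->
    distribution P X A = (\int[lebesgue_rV p]_(x in C `&` A)
      (w x / (\int[lebesgue_rV p]_(y in C) w y)%R)%:E)%E.

Definition exp_samp_output d (Omega : measurableType d)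
    (P : probability Omega R) (eps L : R) C (loss : 'rV[R]_p -> R)
    (X : {RV P >-> 'rV[R]_p}) :=
  has_density_prop_to X C
    (fun theta => expR (- (eps / (2 * L * diameter2 C)) * loss theta)).

End exponential_sampling.

(* Main.v *)
Require Import Defs.
From HB Require Import structures.
From mathcomp Require Import all_boot all_order all_algebra.
From mathcomp Require Import all_classical all_reals all_analysis.
From mathcomp Require Import measurable_realfun ring lra.

(* Put lam = eps / (2 L diam C), let x0 be the minimizer, F x = f x - f x0.  By
   convexity the contraction T x = (x + x0) / 2 maps C into itself and
   F (T x) <= F x / 2, so exp(- lam F x / 2) <= exp(- lam F (T x)).  Integrating
   over C and changing variables, T scaling volumes by 2^-p, the sampling law
   satisfies E[exp(lam F / 2)] <= 2^p; Jensen's inequality, in the form of the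
   tangent line of exp at p ln 2, gives E[F] <= 2 p ln 2 / lam. *)

Set Implicit Arguments.
Unset Strict Implicit.
Unset Printing Implicit Defensive.
Import Order.TTheory GRing.Theory Num.Theory.
Import numFieldNormedType.Exports.

Local Open Scope classical_set_scope.
Local Open Scope ring_scope.

(** * Integration against a density, and comparison of integrals off a null set *)

Section integral_extra.
Context {d} {T : measurableType d} {R : realType}.
Local Open Scope ereal_scope.
Import HBNNSimple.

(** Linearity reduces simple functions to the hypothesis on [nu A]; [nnsfun_approx] and monotone
    convergence carry the identity over to [f]. *)
Lemma ge0_integral_density (mu nu : {measure set T -> \bar R}) (g : T -> R)
    (f : T -> \bar R) :
  measurable_fun setT g -> (forall x, 0 <= g x)%R ->
  (forall A, measurable A -> nu A = \int[mu]_(x in A) (g x)%:E) ->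
  measurable_fun setT f -> (forall x, 0 <= f x) ->
  \int[nu]_x f x = \int[mu]_x (f x * (g x)%:E).
Proof.
move=> mg g0 nug mf f0; pose h := nnsfun_approx measurableT mf.
have hf x : (EFin \o h ^~ x) n @[n --> \oo] --> f x.
  by apply: cvg_nnsfun_approx => // y _; exact: f0.
have nd_h x : {homo (fun n => (h n x)%:E) : m n / (m <= n)%N >-> m <= n}.
  by move=> m n mn; rewrite lee_fin; exact/lefP/nd_nnsfun_approx.
have mEg : measurable_fun setT (EFin \o g) by exact/measurable_EFinP.
have mind r (A : set T) : measurable A ->
    measurable_fun setT (fun x => (r * \1_A x)%:E).
  by move=> mA; apply/measurable_EFinP; exact: measurable_funM.
transitivity (limn (fun n => \int[nu]_x (h n x)%:E)).
  rewrite -monotone_convergence//.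
  - by apply: eq_integral => x _; apply/esym/cvg_lim => //; exact: hf.
  - by move=> n; exact/measurable_EFinP/measurable_funP.
  - by move=> n x _; rewrite lee_fin.
transitivity (limn (fun n => \int[mu]_x ((h n x)%:E * (g x)%:E))); last first.
  rewrite -monotone_convergence//.
  - apply: eq_integral => x _; apply/cvg_lim => //.
    by apply: cvgeZr => //; exact: hf.
  - move=> n; apply: emeasurable_funM => //.
    exact/measurable_EFinP/measurable_funP.
  - by move=> n x _; rewrite mule_ge0// lee_fin.
  - by move=> x _ m n mn; rewrite lee_wpmul2r ?lee_fin//; exact: nd_h.
congr (limn _); apply/funext => n.
transitivity (\int[nu]_x
    (\sum_(y \in range (h n)) (y * \1_(h n @^-1` [set y]) x)%:E)).
  by apply: eq_integral => x _; rewrite fsumEFin// -fimfunE.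
rewrite ge0_integral_fsum//; last 2 first.
- by move=> y; exact: mind.
- by move=> y x _; exact: nnfun_muleindic_ge0.
transitivity (\int[mu]_x (\sum_(y \in range (h n))
    ((y * \1_(h n @^-1` [set y]) x)%:E * (g x)%:E))); last first.
  apply: eq_integral => x _; rewrite -ge0_mule_fsuml.
    by rewrite fsumEFin// -fimfunE.
  by move=> y; exact: nnfun_muleindic_ge0.
rewrite ge0_integral_fsum//; last 2 first.
- by move=> y; apply: emeasurable_funM => //; exact: mind.
- by move=> y x _; rewrite mule_ge0 ?lee_fin ?g0//; exact: nnfun_muleindic_ge0.
apply: eq_fsbigr => r; rewrite inE => -[t _ <-].
rewrite integralZl_indic_nnsfun// integral_indic// setIT nug//.
under [RHS]eq_integral do rewrite EFinM -muleA.
rewrite ge0_integralZl//.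
- congr (_ * _); rewrite [LHS]integral_mkcond.
  apply: eq_integral => x _; rewrite patchE indicE.
  by case: ifP; rewrite ?mul1e ?mul0e.
- apply: emeasurable_funM => //.
  by apply/measurable_EFinP; exact: measurable_indic.
- by move=> x _; rewrite mule_ge0 ?lee_fin.
- by rewrite lee_fin.
Qed.

(* [f] need not be measurable: its integral is at most the supremum of the
   integrals of the simple functions below its positive part. *)
Lemma integral_le_ae_ge0 (mu : {measure set T -> \bar R}) (D : set T)
    (f g : T -> \bar R) :
  measurable D -> mu (~` D) = 0 -> measurable_fun setT g ->
  (forall x, 0 <= g x) -> (forall x, D x -> f x <= g x) ->
  \int[mu]_x f x <= \int[mu]_x g x.
Proof.
move=> mD muD mg g0 fg; rewrite integralE.
apply: (@le_trans _ _ (\int[mu]_x f^\+ x)).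
  rewrite -[leRHS]adde0 leeD2l// oppe_le0; exact: integral_ge0.
(* Raising the bound to [+oo] off [D] changes it on a null set only, and makes it dominate the
   positive part of [f] everywhere. *)
pose g' x := if x \in D then g x else +oo.
have -> : \int[mu]_x g x = \int[mu]_x g' x.
  have mg' : measurable_fun setT g'.
    apply: measurable_fun_if => //.
    - apply: (measurable_fun_bool true).
      rewrite setTI (_ : _ @^-1` _ = D)//.
      by apply/seteqP; split=> x; [exact: set_mem|exact: mem_set].
    - exact: measurable_funS mg.
  apply: ge0_ae_eq_integral => //.
    by move=> x _; rewrite /g'; case: ifP => // _; rewrite leey.
  exists (~` D); split => //; first exact: measurableC.
  move=> x /= h Dx; apply: h => _; rewrite /g' ifT// inE//.
rewrite !ge0_integralTE//; last by move=> x; rewrite /g'; case: ifP.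
apply: ereal_sup_le => _ [h hf <-]; exists h => // x.
apply: le_trans (hf x) _; rewrite /g'; case: ifPn => [|_]; last exact: leey.
by rewrite inE => Dx; rewrite funeposE ge_max fg// g0.
Qed.

End integral_extra.

(** * Borel sets of R^p and measurability of Lipschitz functions *)

Section borel_rV_extra.
Context {R : realType} {p : nat}.

Lemma measurable_box_rV (I : 'I_p -> interval R) :
  measurable [set v : 'rV[R]_p | forall i, v ord0 i \in I i].
Proof.
rewrite (_ : [set v | _] = \bigcap_(i in [set: 'I_p])
    ((fun v : 'rV[R]_p => v ord0 i) @^-1` [set` I i])).
  apply: fin_bigcap_measurable => // i _; rewrite -[X in measurable X]setTI.
  by apply: measurable_coord => //; exact: measurable_itv.
by apply/seteqP; split => [v h i _|v h i]; [exact: h|exact: (h i Logic.I)].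
Qed.

(** Balls of the sup norm are boxes, so an open set is the union of the countably many boxes with
    rational centre and radius [1/(n+1)] that it contains. *)
Lemma open_measurable_rV (U : set 'rV[R]_p) : open U -> measurable U.
Proof.
move=> oU.
pose B (k : 'rV[rat]_p * nat) := [set v : 'rV[R]_p | forall i,
  v ord0 i \in `](ratr (k.1 ord0 i) - k.2.+1%:R^-1),
                 (ratr (k.1 ord0 i) + k.2.+1%:R^-1)[].
rewrite (_ : U = \bigcup_k if `[< B k `<=` U >] then B k else set0).
  apply: countable_bigcupT_measurable => // k.
  by case: ifP => // _; exact: measurable_box_rV.
apply/seteqP; split => [x Ux|x [k _]]; last first.
  by case: ifPn => // /asboolP kU /kU.
have /nbhs_ballP[e /= e0 xeU] : nbhs x U by exact: open_nbhs_nbhs.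
(* A box of radius below [e / 2] whose centre is within that radius of [x] stays within [e] of
   [x]. *)
have [n ne] : exists n : nat, n.+1%:R^-1 < e / 2.
  exists (Num.truncn (e / 2)^-1); rewrite invf_plt ?posrE//; last by lra.
  exact: truncnS_gt.
have n0 : 0 < n.+1%:R^-1 :> R by rewrite invr_gt0.
have /fin_all_exists[q qP] (i : 'I_p) : exists q : rat,
    ratr q \in `](x ord0 i - n.+1%:R^-1), (x ord0 i + n.+1%:R^-1)[.
  by apply: rat_in_itvoo; rewrite ltrD2l (lt_trans _ n0)// oppr_lt0.
exists (\row_i q i, n) => //; rewrite ifT /B/=.
  move=> i; have := qP i; rewrite mxE !in_itv/=.
  move: (n.+1%:R^-1) => e'; lra.
apply/asboolP => v vB; apply: xeU; split => // i j; rewrite (ord1 i) /ball/=.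
have := vB j; have := qP j; rewrite mxE !in_itv/= ltr_norml.
move: (n.+1%:R^-1) ne => e'; lra.
Qed.

Lemma closed_measurable_rV (C : set 'rV[R]_p) : closed C -> measurable C.
Proof.
move=> cC; rewrite -[C]setCK; apply: measurableC.
by apply: open_measurable_rV; exact: closed_openC.
Qed.

Lemma norm2_le (v : 'rV[R]_p) (e : R) :
  0 <= e -> (forall i, `|v ord0 i| <= e) -> norm2 v <= p%:R * e.
Proof.
move=> e0 ve; rewrite -[leRHS]ger0_norm ?mulr_ge0// -sqrtr_sqr ler_wsqrtr//.
apply: (@le_trans _ _ (\sum_(i < p) e ^+ 2)).
  by apply: ler_sum => i _; rewrite -real_normK ?num_real// lerXn2r ?nnegrE.
rewrite sumr_const card_ord -[e ^+ 2 *+ p]mulr_natl exprMn.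
apply: ler_wpM2r; first exact: sqr_ge0.
by rewrite expr2 -natrM ler_nat; case: (posnP p) => [->|/leq_pmull->].
Qed.

Lemma lipschitz2_measurable (L : R) (C : set 'rV[R]_p) (f : 'rV[R]_p -> R) :
  0 < L -> measurable C -> lipschitz2_on L C f -> measurable_fun C f.
Proof.
move=> L0 mC lf; apply: (measurability _ (RGenOInfty.measurableE R)).
move=> _ [_ [a ->] <-].
pose A := C `&` f @^-1` `]a, +oo[.
(* [A] is the trace on [C] of an open set: near a point of [A], the Lipschitz bound keeps [f] above
   [a] on [C]. *)
rewrite -/A (_ : A = C `&` (A `|` ~` C)°); last first.
  apply/seteqP; split=> x [Cx]; last by move=> /interior_subset[].
  rewrite /= in_itv/= andbT => ax; split => //; apply/nbhs_ballP.
  (* On the sup-norm ball of radius [e], [f] drops by at most [L * p * e < f x - a]; using [p.+1]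
     makes this strict and covers [p = 0]. *)
  pose e := (f x - a) / (L * p.+1%:R).
  have e0 : 0 < e by rewrite divr_gt0 ?mulr_gt0// subr_gt0.
  exists e => //= y [_ xy].
  have [Cy|nCy] := pselect (C y); [left; split => //=|by right].
  have := lf _ _ (mem_set Cx) (mem_set Cy).
  have : norm2 (x - y) <= p%:R * e.
    apply: norm2_le; first exact: ltW.
    by move=> i; rewrite !mxE; apply: ltW; exact: xy.
  rewrite in_itv/= andbT -(ler_pM2l L0) => h1 /le_trans/(_ h1).
  rewrite ler_norml => /andP[_].
  have : L * (p%:R * e) < f x - a.
    rewrite /e mulrA mulrCA gtr_pMr ?subr_gt0//.
    by rewrite ltr_pdivrMr ?mulr_gt0// mul1r ltr_pM2l// ltr_nat.
  lra.
by apply: measurableI => //; apply: open_measurable_rV; exact: open_interior.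
Qed.

End borel_rV_extra.

(** * Effect of homotheties on Lebesgue measure and integrals *)

Lemma ge0_integral_comp_scaling d (T : measurableType d) (R : realType)
    (mu : {measure set T -> \bar R}) (phi : T -> T) (k : R)
    (f : T -> \bar R) :
  0 <= k -> measurable_fun setT phi ->
  (forall A, measurable A -> mu (phi @^-1` A) = k%:E * mu A)%E ->
  measurable_fun setT f -> (forall x, 0 <= f x)%E ->
  (\int[mu]_x f (phi x) = k%:E * \int[mu]_x f x)%E.
Proof.
move=> k0 mphi muphi mf f0.
rewrite -[LHS](ge0_integral_pushforward mphi mu measurableT)//.
rewrite -[k]/((NngNum k0)%:num) -ge0_integral_mscale//.
by apply: eq_measure_integral => A mA _; exact: muphi.
Qed.

Section lebesgue_rV_homothety.
Context {R : realType}.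
Local Open Scope ereal_scope.

(** By uniqueness of Lebesgue measure: [s] times its pushforward has the right value on half-open
    intervals. *)
Lemma lebesgue_measure_homothety (s a : R) (A : set R) :
  (0 < s)%R -> measurable A ->
  lebesgue_measure ((fun t => s * t + a)%R @^-1` A) =
  s^-1%:E * lebesgue_measure A.
Proof.
move=> s0 mA.
pose phi (t : measurableTypeR R) : measurableTypeR R := (s * t + a)%R.
have mphi : measurable_fun setT phi.
  by apply: measurable_funD => //; exact: measurable_funM.
pose nu' : {measure set (measurableTypeR R) -> \bar R} :=
  mscale (NngNum (ltW s0)) (pushforward lebesgue_measure phi).
pose nu := nu' mphi.
have -> : lebesgue_measure A = nu A.
  apply: lebesgue_measure_unique mA => _ [[b c]/= bc <-].
  rewrite /nu /nu' /mscale/= /pushforward.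
  have -> : phi @^-1` `]b, c] =
      [set` `]((b - a) / s)%R, ((c - a) / s)%R]].
    apply/seteqP; split=> t/=; rewrite /phi !in_itv/=;
      by rewrite ltr_pdivrMr// ler_pdivlMr// ltrBlDr lerBrDr mulrC.
  rewrite !lebesgue_measure_itv/= !lte_fin ltr_pM2r ?invr_gt0// ltrD2r.
  case: ifPn => bc'; last by rewrite mule0.
  by rewrite -!EFinB -EFinM; congr EFin; field; rewrite gt_eqF.
by rewrite /nu /nu' /mscale/= muleA -EFinM mulVf ?gt_eqF// mul1e.
Qed.

Lemma measurable_homothety_rV p (s : R) (v : 'rV[R]_p) :
  measurable_fun setT (fun x : 'rV[R]_p => s *: x + v)%R.
Proof.
apply: measurable_fun_rV => i.
rewrite (_ : (fun x => _) = (fun x : 'rV[R]_p => s * x ord0 i + v ord0 i)%R).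
  apply: measurable_funD => //; apply: measurable_funM => //.
  exact: measurable_coord.
by apply/funext => x; rewrite !mxE.
Qed.

(** Induction on the dimension: after slicing along the first coordinate, the one-dimensional case
    yields one factor [s^-1], and the change of variables in the remaining coordinates yields the
    others. *)
Lemma lebesgue_rV_homothety p (s : R) (v : 'rV[R]_p) (A : set 'rV[R]_p) :
  (0 < s)%R -> measurable A ->
  lebesgue_rV p ((fun x : 'rV[R]_p => s *: x + v)%R @^-1` A) =
  ((s^-1) ^+ p)%:E * lebesgue_rV p A.
Proof.
move=> s0; elim: p v A => [|p IH] v A mA.
  rewrite expr0 mul1e; congr (_ _); apply/seteqP.
  by split=> x /=; rewrite [(_ + _)%R]thinmx0 [x]thinmx0.
pose v' : 'rV[R]_p := \row_i v ord0 (lift ord0 i).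
pose F (x : 'rV[R]_p) := lebesgue_measure (xsection (@cons_rV R p @^-1` A) x).
have mA' : measurable (@cons_rV R p @^-1` A).
  by rewrite -[X in measurable X]setTI; exact: measurable_cons_rV.
have mF : measurable_fun setT F by exact: measurable_fun_xsection.
transitivity (\int[lebesgue_rV p]_x
    (s^-1%:E * F (s *: x + v')%R)).
  rewrite /= /pushforward /product_measure1.
  apply: eq_integral => x _ /=.
  rewrite -(lebesgue_measure_homothety (v ord0 ord0)) //; last first.
    exact: measurable_xsection.
  (* The slice of the preimage over [x] is the one-dimensional homothetic preimage of the slice of
     [A] over [s *: x + v']. *)
  congr (lebesgue_measure _); apply/seteqP.
  have consE t : (s *: cons_rV (x, t) + v)%R =
      cons_rV ((s *: x + v')%R, (s * t + v ord0 ord0)%R).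
    apply/rowP => i; rewrite [LHS]mxE [X in (X + _)%R]mxE.
    have [j ->|->] := unliftP ord0 i.
      by rewrite !cons_rV_lift/= !mxE.
    by rewrite !cons_rV0.
  by split=> t /=; rewrite /xsection/= !inE/= consE.
rewrite ge0_integralZl//.
- rewrite (ge0_integral_comp_scaling _ _ (IH _))//.
  + by rewrite muleA -EFinM -exprS.
  + by rewrite exprn_ge0// invr_ge0 ltW.
  + exact: measurable_homothety_rV.
- by apply: measurableT_comp => //; exact: measurable_homothety_rV.
- by rewrite lee_fin invr_ge0 ltW.
Qed.

End lebesgue_rV_homothety.

(** * Exponential moment and expected gap of the sampling law *)

Section exponential_sampling_gap.
Context {R : realType} {p : nat}.
Variables (C : set 'rV[R]_p) (f : 'rV[R]_p -> R) (x0 : 'rV[R]_p) (lam : R).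
Hypotheses (lam0 : 0 < lam) (mC : measurable C) (mf : measurable_fun C f).
Hypothesis f_min : is_argmin C f x0.
(** The form in which convexity enters: at midpoints with the minimizer, the images under the
    contraction [T]. *)
Hypothesis C_half : forall x, C x -> C (2^-1 *: x + 2^-1 *: x0).
Hypothesis f_half : forall x, C x ->
  f (2^-1 *: x + 2^-1 *: x0) <= (f x + f x0) / 2.

Context {d : measure_display} {Omega : measurableType d}.
Variables (P : probability Omega R) (X : {RV P >-> 'rV[R]_p}).
Hypothesis X_density :
  has_density_prop_to X C (fun x => expR (- lam * f x)).

Local Notation mu := (lebesgue_rV p).
Local Notation nu := (distribution P X).

Let Z := (\int[mu]_(y in C) expR (- lam * f y))%R.
(** Extension by zero off [C] turns the density and the gap into measurable nonnegative functions on
    all of R^p. *)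
Let g : 'rV[R]_p -> R := (fun x => expR (- lam * f x) / Z) \_ C.
Let gap : 'rV[R]_p -> R := (fun x => f x - f x0) \_ C.
Let T (x : 'rV[R]_p) : 'rV[R]_p := 2^-1 *: x + 2^-1 *: x0.

Let mg : measurable_fun setT g.
Proof.
apply: (measurable_restrictT _ mC).1; apply: measurable_funM => //.
by apply: measurableT_comp => //; exact: measurable_funM.
Qed.

Let Z_ge0 : 0 <= Z.
Proof. by apply: Rintegral_ge0 => x _; exact: expR_ge0. Qed.

Let g_ge0 x : 0 <= g x.
Proof.
by rewrite /g patchE; case: ifP => // _; rewrite divr_ge0// expR_ge0.
Qed.

Let nu_density A : measurable A -> nu A = (\int[mu]_(x in A) (g x)%:E)%E.
Proof.
move=> mA; rewrite X_density// integral_mkcondl; apply: eq_integral => x _.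
by rewrite /g !patchE; case: ifP.
Qed.

(** The normalisation comes from the total mass of [P], which avoids proving that [Z] is finite and
    nonzero. *)
Let integral_g : (\int[mu]_x (g x)%:E = 1)%E.
Proof. by rewrite -nu_density// probability_setT. Qed.

Let mgap : measurable_fun setT gap.
Proof. by apply: (measurable_restrictT _ mC).1; exact: measurable_funB. Qed.

Let gap_ge0 x : 0 <= gap x.
Proof.
rewrite /gap patchE; case: ifP => // xC; rewrite subr_ge0.
by case: f_min => _; apply.
Qed.

Let integral_expR_gap :
  (\int[nu]_x (expR (lam / 2 * gap x))%:E <= (2 ^+ p)%:E)%E.
Proof.
have mE : measurable_fun setT (fun x => (expR (lam / 2 * gap x))%:E).
  apply/measurable_EFinP; apply: measurableT_comp => //.
  exact: measurable_funM.
have mT : measurable_fun setT T by exact: measurable_homothety_rV.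
rewrite (ge0_integral_density mg g_ge0 nu_density mE); last first.
  by move=> x; rewrite lee_fin expR_ge0.
(* The integrand is at most [g (T x)] pointwise; off [C] it is 0. *)
apply: (@le_trans _ _ (\int[mu]_x (g (T x))%:E)%E).
  apply: ge0_le_integral => //.
  - by move=> x _; rewrite mule_ge0// lee_fin ?expR_ge0.
  - by apply: emeasurable_funM => //; exact/measurable_EFinP.
  - by apply/measurable_EFinP; exact: measurableT_comp mT.
  move=> x _; rewrite -EFinM lee_fin /g /gap !patchE.
  have [xC|_] := boolP (x \in C); last by rewrite mulr0; exact: g_ge0.
  rewrite ifT; last by apply/mem_set/C_half; exact: set_mem.
  rewrite mulrA -expRD ler_wpM2r ?invr_ge0// ler_expR.
  (* The exponents satisfy [lam / 2 * (f x - f x0) - lam * f x <= - lam * f (T x)], which is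
     [f_half] multiplied by [lam]. *)
  have := f_half (set_mem xC); rewrite -/(T x) -(ler_pM2l lam0); lra.
(* [T] has ratio 1/2, so preimages under it have [2 ^ p] times the volume. *)
rewrite [leLHS](ge0_integral_comp_scaling (k := 2 ^+ p) (f := EFin \o g) _ mT)
  ?exprn_ge0//.
- by rewrite integral_g mule1.
- by move=> A mA; rewrite [LHS](lebesgue_rV_homothety (2^-1 *: x0))// invrK.
- exact/measurable_EFinP.
Qed.

Lemma exp_samp_gap_le :
  ('E_P[fun w => (f (X w) - f x0)%R] <= (p%:R * (2 * ln 2) / lam)%:E)%E.
Proof.
rewrite unlock.
have mX : measurable_fun setT X by exact: measurable_funPT.
(* [f] is known to be measurable on [C] only, so the integrand is replaced by the measurable [gap],
   which agrees with it almost surely: the law of [X] gives the complement of [C] mass 0. *)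
apply: (@le_trans _ _ (\int[P]_w (gap (X w))%:E)%E).
  apply: (@integral_le_ae_ge0 _ _ _ _ (X @^-1` C)).
  - by rewrite -[X in measurable X]setTI; exact: mX.
  - rewrite preimage_setC -[LHS]/(nu (~` C)) X_density; last exact: measurableC.
    by rewrite setICr integral_set0.
  - by apply/measurable_EFinP; exact: measurableT_comp.
  - by move=> w; rewrite lee_fin.
  - by move=> w XwC; rewrite lee_fin /gap patchE ifT// inE.
rewrite -(ge0_integral_distribution X (f := EFin \o gap)) /=; last 2 first.
- exact/measurable_EFinP.
- by move=> x; rewrite lee_fin.
(* [c = 2^-p] is the reciprocal slope of the tangent to [expR] at [p * ln 2]; the tangent inequality
   is scaled by it. *)
pose c : R := expR (- (p%:R * ln 2)).
have c2 : c * 2 ^+ p = 1.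
  by rewrite /c mulrC expRN expRM_natl lnK ?posrE// divff// expf_neq0.
have tangent x :
    lam / 2 * gap x + 1 <= c * expR (lam / 2 * gap x) + p%:R * ln 2.
  by rewrite /c -expRD -lerBlDr addrC; apply: le_trans (expR_ge1Dx _); lra.
have nuT : nu setT = 1%E by rewrite probability_setT.
have ln2 : 0 <= p%:R * ln 2 :> R by rewrite mulr_ge0// ln_ge0 ?ler1n.
have mE : measurable_fun setT (fun x => (expR (lam / 2 * gap x))%:E).
  apply/measurable_EFinP; apply: measurableT_comp => //.
  exact: measurable_funM.
have int_cst (r : R) : (\int[nu]_x r%:E = r%:E)%E.
  by rewrite integral_cst//= [X in (_ * X)%E]nuT mule1.
have mcE : measurable_fun setT
    (fun x => c%:E * (expR (lam / 2 * gap x))%:E)%E.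
  by apply: emeasurable_funM => //; exact: measurable_cst.
have mlin : measurable_fun setT (fun x => (lam / 2)%:E * (gap x)%:E)%E.
  by apply/measurable_EFinP; exact: measurable_funM.
have cE_ge0 x : (0 <= c%:E * (expR (lam / 2 * gap x))%:E)%E.
  by rewrite mule_ge0// lee_fin expR_ge0.
have lin_ge0 x : (0 <= (lam / 2)%:E * (gap x)%:E)%E.
  by rewrite mule_ge0// lee_fin// divr_ge0// ltW.
(* The constants are placed so that both integrands are nonnegative, which gives linearity without
   integrability of the gap. *)
have lin : ((lam / 2)%:E * \int[nu]_x (gap x)%:E + 1 <=
    c%:E * \int[nu]_x (expR (lam / 2 * gap x))%:E + (p%:R * ln 2)%:E)%E.
  have -> : ((lam / 2)%:E * \int[nu]_x (gap x)%:E =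
      \int[nu]_x ((lam / 2)%:E * (gap x)%:E))%E.
    rewrite ge0_integralZl// ?lee_fin ?divr_ge0 ?ltW//.
      exact/measurable_EFinP.
    by move=> x _; rewrite lee_fin.
  have -> : (c%:E * \int[nu]_x (expR (lam / 2 * gap x))%:E =
      \int[nu]_x (c%:E * (expR (lam / 2 * gap x))%:E))%E.
    by rewrite ge0_integralZl// lee_fin expR_ge0.
  rewrite -(int_cst 1) -(int_cst (p%:R * ln 2)) -!ge0_integralD//=.
  apply: ge0_le_integral => //=.
  - by move=> x _; rewrite adde_ge0.
  - exact: emeasurable_funD.
  - exact: emeasurable_funD.
  - by move=> x _; rewrite -!EFinM -!EFinD lee_fin.
(* By the moment bound and [c * 2 ^ p = 1], the first term on the right is at most 1 and cancels the
   [1] on the left. *)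
have {}lin : ((lam / 2)%:E * \int[nu]_x (gap x)%:E <= (p%:R * ln 2)%:E)%E.
  rewrite -(@leeD2rE _ 1%E)//; apply: le_trans lin _.
  rewrite addeC leeD2l//.
  have -> : 1%E = (c%:E * (2 ^+ p)%:E)%E by rewrite -EFinM c2.
  by rewrite lee_wpmul2l// lee_fin expR_ge0.
rewrite (_ : _ / lam = (lam / 2)^-1 * (p%:R * ln 2)); last first.
  by field; rewrite gt_eqF.
by rewrite EFinM lee_pdivlMl// divr_gt0.
Qed.

End exponential_sampling_gap.

(** * Lipschitz and diameter bounds, then the risk bound *)

Lemma lipschitz2_emp_loss (R : realType) (p n : nat) (C : set 'rV[R]_p)
    (D : Type) (loss : 'rV[R]_p -> D -> R) (L : R) (data : n.-tuple D) :
  (forall x, lipschitz2_on L C (loss ^~ x)) ->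
  lipschitz2_on (n%:R * L) C (emp_loss loss data).
Proof.
move=> lip x y xC yC; rewrite /emp_loss -sumrB.
apply: le_trans (ler_norm_sum _ _ _) _.
apply: (@le_trans _ _ (\sum_(i < n) L * norm2 (x - y))).
  by apply: ler_sum => i _; exact: lip.
by rewrite sumr_const card_ord -[leLHS]mulr_natl mulrA.
Qed.

(** Boundedness of [C] makes the real-valued [sup] in [diameter2] a genuine upper bound. *)
Lemma norm2_le_diameter2 (R : realType) (p : nat) (C : set 'rV[R]_p)
    (x y : 'rV[R]_p) :
  bounded_set C -> C x -> C y -> norm2 (x - y) <= diameter2 C.
Proof.
move=> [M [Mreal CM]] Cx Cy; apply: ub_le_sup; last by exists x => //; exists y.
(* [bounded_set] bounds norms by every real strictly above [M], and [M] may be negative; [B] is a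
   nonnegative such real. *)
pose B := Num.max M 0 + 1.
have [MB B0] : M < B /\ 0 <= B by rewrite /B; split; [|]; case: (leP M 0); lra.
exists (p%:R * (B + B)) => _ [u Cu [v Cv <-]].
apply: norm2_le => [|i]; first by rewrite addr_ge0.
have entry_le (w : 'rV[R]_p) : C w -> `|w ord0 i| <= B.
  move=> Cw; apply: le_trans (CM B MB w Cw).
  rewrite [leRHS]/Num.norm/= mx_normrE; apply/bigmax_geP; right => /=.
  by exists (ord0, i).
by rewrite !mxE; apply: le_trans (ler_normB _ _) _; rewrite lerD ?entry_le.
Qed.

Theorem theorem3p2 (R : realType) :
  exists K : R, 0 < K /\
    forall (p : nat) (C : set 'rV[R]_p) (D : Type)
      (loss : 'rV[R]_p -> D -> R) (L eps : R),
    closed C -> bounded_set C -> convex_set C -> C° !=set0 ->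
    0 < L -> 0 < eps ->
    (forall x : D, convex_function C (loss ^~ x)) ->
    (forall x : D, lipschitz2_on L C (loss ^~ x)) ->
    forall (n : nat) (data : n.-tuple D) (theta_star : 'rV[R]_p),
    is_argmin C (emp_loss loss data) theta_star ->
    forall (d : measure_display) (Omega : measurableType d)
      (P : probability Omega R) (theta_priv : {RV P >-> 'rV[R]_p}),
    exp_samp_output eps L C (emp_loss loss data) theta_priv ->
    ('E_P[fun w => (emp_loss loss data (theta_priv w)
                   - emp_loss loss data theta_star)%R]
      <= (K * (p%:R * L * diameter2 C / eps))%:E)%E.
Proof.
(* [2 p ln 2 / lam] with [lam = eps / (2 L diam)] equals [4 ln 2 * p L diam / eps]. *)
exists (4 * ln 2); split; first by rewrite mulr_gt0// ln_gt0// ltr1n.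
move=> p C D loss L eps cC bC convC _ L0 eps0 conv_loss lip_loss n data x0.
move=> x0min d Omega P X; rewrite /exp_samp_output; set f := emp_loss loss data.
move=> Xdens; have Cx0 : C x0 by case: x0min => /set_mem.
have mC := closed_measurable_rV cC.
have mf : measurable_fun C f.
  apply: measurable_sum => i.
  exact: lipschitz2_measurable L0 mC (lip_loss _).
have /orP : (diameter2 C == 0) || (0 < diameter2 C).
  rewrite -le0r; apply: le_trans (norm2_le_diameter2 bC Cx0 Cx0).
  exact: sqrtr_ge0.
case=> [/eqP diam0|diam0].
  (* Here [lam] is 0 by the convention for division, so the moment argument does not apply. Instead,
     all distances in [C] vanish, and the Lipschitz bound makes the gap nonpositive almost
     surely. *)
  rewrite diam0 mulr0 mul0r mulr0 unlock.
  have mXC : measurable (X @^-1` C).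
    by rewrite -[X in measurable X]setTI; exact: measurable_funPT.
  rewrite -[leRHS](integral0 P setT).
  apply: (integral_le_ae_ge0 (D := X @^-1` C)) => //.
    rewrite preimage_setC -[LHS]/(distribution P X (~` C)) Xdens.
      by rewrite setICr integral_set0.
    exact: measurableC.
  move=> w XwC; rewrite lee_fin; apply: le_trans (ler_norm _) _.
  apply: le_trans.
    exact: (lipschitz2_emp_loss data lip_loss (mem_set XwC) (mem_set Cx0)).
  rewrite mulr_ge0_le0 ?mulr_ge0 ?(ltW L0)// -diam0.
  exact: norm2_le_diameter2.
have half_ge0 : 0 <= 2^-1 :> R by rewrite invr_ge0.
have half_le1 : 2^-1 <= 1 :> R by rewrite invf_le1// ler1n.
pose half := Itv01 half_ge0 half_le1.
have onem_half : 1 - 2^-1 = 2^-1 :> R by lra.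
have convE (V : lmodType R) (x y : V) :
    conv half (x : convex_lmodType V) y = 2^-1 *: x + 2^-1 *: y.
  by rewrite -[in RHS in _ + RHS]onem_half.
have := @exp_samp_gap_le _ _ C f x0 (eps / (2 * L * diameter2 C)) _ mC mf
  x0min _ _ _ _ P X Xdens.
rewrite (_ : _ / (_ / _) = 4 * ln 2 * (p%:R * L * diameter2 C / eps)).
  apply.
  - by rewrite divr_gt0// !mulr_gt0.
  - move=> x Cx.
    have := convC x x0 half (mem_set Cx) (mem_set Cx0).
    by rewrite convE => /set_mem.
  - move=> x Cx.
    rewrite mulrDl !mulr_suml -big_split/=; apply: ler_sum => i _.
    have := conv_loss (tnth data i) half x x0 (mem_set Cx) (mem_set Cx0).
    by rewrite convE convRE/= [X in _ + X * _]onem_half ![2^-1 * _]mulrC.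
by field; rewrite ?gt_eqF.
Qed.
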